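(* Let $n\ge1$. The full strongly exceptional collection $\{\mathcal L_{\operatorname{IP}(\Omega)}\}$ of nef line bundles on $\operatorname{Stell}_n$, indexed by all Schubert matroids $\Omega$ on $[n]$, is $S_n$-invariant.
   Context: Work over an algebraically closed field of characteristic $0$. Let $N=M=\mathbb Z^n$. The stellahedron is $\{x\in\mathbb R^n_{\ge0}:y-x\in\mathbb R^n_{\ge0}\text{ for some }y\in\pi_n\}$ with $\pi_n=\operatorname{conv}(g\cdot(1,\dots,n):g\in S_n)$; the stellahedral fan is its normal fan (cones $\overline{\{\alpha:P_\alpha=F\}}$, $P_\alpha$ the face on which $\alpha$ is maximal), and $\operatorname{Stell}_n$ its toric variety. $S_n$ acts on $N$ by $w(e_i)=e_{w(i)}$, preserving the fan, hence acts on $\operatorname{Stell}_n$. For a lattice polytope $P$ whose normal fan coarsens the stellahedral fan, $\mathcal L_P=\mathcal O(\sum_\rho a_\rho D_\rho)$ with $a_\rho=\max_{x\in P}\langle x,v_\rho\rangle$, $v_\rho$ the primitive generator of the ray $\rho$. A collection of sheaves $\{\mathcal E_i\}$ is invariant under a group $G$ acting on the variety if for all $g\in G$ and all $i$, the sheaf $g\cdot\mathcal E_i$ (transport of $\mathcal E_i$ along the automorphism $g$) is isomorphic to some $\mathcal E_j$ in the collection. Schubert matroids: for $w\in S_n$ let $\le_w$ be the induced linear order on $[n]$ and the Gale order on $k$-subsets: $\{i_1<_w\dots<_wi_k\}\le_w\{j_1<_w\dots<_wj_k\}$ iff $i_a\le_wj_a$ for all $a$. For $|S|=k$, $\Omega_S^w$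 is the matroid with bases $\{T\in\binom{[n]}k:S\le_wT\}$; Schubert matroids are the matroids of this form. $\operatorname{IP}(\Omega)=\operatorname{conv}(e_I:I\text{ an independent set of }\Omega)$, $e_I=\sum_{i\in I}e_i$. *)

(* Defs.v *)
From HB Require Import structures.
From mathcomp Require Import all_boot all_order all_fingroup all_algebra.
From mathcomp Require Import boolp classical_sets functions cardinality fsbigop.
From mathcomp Require Import reals topology normedtype.
(* Not imported in full: the notations of mpoly clash with those of normedtype. *)
From mathcomp Require mpoly.
Import (canonicals, coercions) mpoly.

Set Implicit Arguments.
Unset Strict Implicit.
Unset Printing Implicit Defensive.

Import Order.TTheory GRing.Theory Num.Theory.
Import numFieldNormedType.Exports.
Local Open Scope classical_set_scope.
Local Open Scope ring_scope.

(* w(e_i) = e_{w(i)}, i.e. (w v)_j = v_{w^-1(j)}. *)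
Definition lact (A : Type) (n : nat) (w : 'S_n) (v : 'rV[A]_n) : 'rV[A]_n :=
  col_perm w^-1%g v.

Lemma lactE (A : Type) (n : nat) (w : 'S_n) (v : 'rV[A]_n) j :
  lact w v 0 j = v 0 (w^-1%g j).
Proof. by rewrite mxE. Qed.

Lemma lactM (A : Type) (n : nat) (g w : 'S_n) (v : 'rV[A]_n) :
  lact w (lact g v) = lact (g * w)%g v.
Proof. by apply/rowP => j; rewrite !lactE invMg permM. Qed.

Lemma lactK (A : Type) (n : nat) (w : 'S_n) :
  cancel (@lact A n w) (lact w^-1%g).
Proof. by move=> v; apply/rowP => j; rewrite !lactE invgK permK. Qed.

Lemma lactVK (A : Type) (n : nat) (w : 'S_n) :
  cancel (@lact A n w^-1%g) (lact w).
Proof. by move=> v; have := lactK w^-1%g v; rewrite invgK. Qed.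

Lemma lactD (A : zmodType) (n : nat) (w : 'S_n) (u v : 'rV[A]_n) :
  lact w (u + v) = lact w u + lact w v.
Proof. by apply/rowP => j; rewrite !(lactE, mxE). Qed.

Lemma lact0 (A : zmodType) (n : nat) (w : 'S_n) : lact w (0 : 'rV[A]_n) = 0.
Proof. by apply/rowP => j; rewrite !(lactE, mxE). Qed.

Section Polytopes.
Context {R : realType} {n : nat}.
Implicit Types (P F : set 'rV[R]_n) (a x y : 'rV[R]_n) (w : 'S_n).

Definition dot x y : R := \sum_i x 0 i * y 0 i.

Definition emb (m : 'rV[int]_n) : 'rV[R]_n := \row_i (m 0 i)%:~R.

Definition conv (A : set 'rV[R]_n) : set 'rV[R]_n :=
  [set x | exists (r : nat) (c : 'I_r -> R) (p : 'I_r -> 'rV[R]_n),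
     [/\ forall i, 0 <= c i, \sum_i c i = 1, forall i, A (p i)
       & x = \sum_i c i *: p i]].

Definition face P a : set 'rV[R]_n :=
  [set x | P x /\ forall y, P y -> dot a y <= dot a x].

Definition normal_fan P : set (set 'rV[R]_n) :=
  [set closure [set b | face P b = face P a] | a in setT].

Definition permutohedron : set 'rV[R]_n :=
  conv [set lact w (\row_i (i.+1)%:R) | w in setT].

Definition stellahedron : set 'rV[R]_n :=
  [set x : 'rV[R]_n | (forall i, 0 <= x 0 i) /\
     exists2 y, permutohedron y & forall i, 0 <= (y - x) 0 i].

Definition stell_fan := normal_fan stellahedron.

Lemma dot_lact w x y : dot (lact w x) (lact w y) = dot x y.
Proof.
rewrite /dot (reindex_perm w); apply: eq_bigr => i _.
by rewrite !lactE permK.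
Qed.

Lemma emb_lact w m : emb (lact w m) = lact w (emb m).
Proof. by apply/rowP => j; rewrite !(lactE, mxE). Qed.

Lemma permutohedron_lact w x : permutohedron x -> permutohedron (lact w x).
Proof.
move=> [r [c [p [c0 c1 Ap ->]]]]; exists r, c, (fun i => lact w (p i)).
split=> // [i|].
  by have [g _ <-] := Ap i; exists (g * w)%g => //; rewrite lactM.
apply/rowP => j; rewrite lactE !summxE; apply: eq_bigr => i _.
by rewrite !(lactE, mxE).
Qed.

Lemma stellahedron_lact w x : stellahedron x -> stellahedron (lact w x).
Proof.
move=> [x0 [y Py yx]]; split=> [i|]; first by rewrite lactE.
exists (lact w y); first exact: permutohedron_lact.
by move=> i; have := yx (w^-1%g i); rewrite !(lactE, mxE).
Qed.

Lemma face_lact w P a : (forall w x, P x -> P (lact w x)) ->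
  face P (lact w a) = lact w @` face P a.
Proof.
move=> Pst; apply/seteqP; split=> [x [Px xmax]|_ [x [Px xmax] <-]].
  exists (lact w^-1%g x); last exact: lactVK.
  split=> [|y Py]; first exact: Pst.
  have := xmax _ (Pst w y Py).
  by rewrite dot_lact -{1}(lactVK w x) dot_lact.
split=> [|y Py]; first exact: Pst.
by rewrite -(lactVK w y) !dot_lact; apply/xmax/Pst.
Qed.

Lemma lact_closure w (A : set 'rV[R]_n) :
  lact w @` closure A `<=` closure (lact w @` A).
Proof.
move=> _ [x clx <-] B [Q nQ sQ].
have [y [Ay By]] : A `&` (lact w @^-1` B) !=set0.
  apply: clx; exists (fun i j => Q i (w j)) => [i j|y yQ].
    have := nQ i (w j).
    by rewrite (_ : lact w x i (w j) = x i j) // mxE permK.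
  apply: sQ => i j; have := yQ i (w^-1%g j).
  by rewrite permKV mxE.
by exists (lact w y); split=> //; exists y.
Qed.

Lemma stell_fan_stable w sigma :
  stell_fan sigma -> stell_fan (lact w @` sigma).
Proof.
move=> [a _ <-]; exists (lact w a) => //.
have st := stellahedron_lact.
have E u a1 b : face stellahedron b = face stellahedron a1 ->
    face stellahedron (lact u b) = face stellahedron (lact u a1).
  by move=> e; rewrite !face_lact ?e.
apply/seteqP; split=> [x clx|].
  exists (lact w^-1%g x); last exact: lactVK.
  have : closure (lact w^-1%g @`
      [set b | face stellahedron b = face stellahedron (lact w a)])
      (lact w^-1%g x) by apply: lact_closure; exists x.
  apply: closureS => _ [b eb <-] /=.
  by rewrite (E _ _ _ eb) lactK.
apply: subset_trans (@lact_closure w _) _.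
by apply: closureS => _ [b eb <-] /=; apply: E.
Qed.

End Polytopes.

Notation ratfun k n := {fraction (mpoly.mpoly n k)}.

Section FracMap.
Context {A : idomainType} (phi : {rmorphism A -> A}) (phi_inj : injective phi).

Definition frac_map (x : {fraction A}) : {fraction A} :=
  tofrac (phi (frac (generic_quotient.repr x)).1) / tofrac (phi (frac (generic_quotient.repr x)).2).

Lemma frac_reprE (x : {fraction A}) :
  x = tofrac (frac (generic_quotient.repr x)).1 / tofrac (frac (generic_quotient.repr x)).2.
Proof.
have d0 : tofrac (frac (generic_quotient.repr x)).2 != 0 by rewrite tofrac_eq0 denom_ratioP.
rewrite -[LHS](mulfK d0); congr (_ / _).
rewrite -{1}[x]generic_quotient.reprK !piE.
apply/eqP; rewrite FracField.equivf_def /FracField.mulf.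
by rewrite !numden_Ratio ?mulf_neq0 ?oner_neq0 ?denom_ratioP // !mulr1 mulrC.
Qed.

Lemma phi_eq0 a : (phi a == 0) = (a == 0).
Proof. by have := inj_eq phi_inj a 0; rewrite rmorph0. Qed.

Lemma frac_mapE a b : b != 0 ->
  frac_map (tofrac a / tofrac b) = tofrac (phi a) / tofrac (phi b).
Proof.
move=> b0; have := frac_reprE (tofrac a / tofrac b); rewrite /frac_map.
set x := generic_quotient.repr _; have d0 : (frac x).2 != 0 := denom_ratioP x.
move/eqP; rewrite eqr_div ?tofrac_eq0 // -!tofracM tofrac_eq => /eqP e.
apply/eqP; rewrite eqr_div ?tofrac_eq0 ?phi_eq0 // -!tofracM tofrac_eq -!rmorphM.
by rewrite e.
Qed.

Lemma frac_map_tofrac a : frac_map (tofrac a) = tofrac (phi a).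
Proof.
have := @frac_mapE a 1 (oner_neq0 _).
by rewrite tofrac1 divr1 rmorph1 tofrac1 divr1.
Qed.

Fact frac_map_is_zmod_morphism : zmod_morphism frac_map.
Proof.
move=> x y; rewrite (frac_reprE x) (frac_reprE y).
move: (frac _).1 (frac _).2 (denom_ratioP (generic_quotient.repr x)) => a b b0.
move: (frac _).1 (frac _).2 (denom_ratioP (generic_quotient.repr y)) => c d d0.
rewrite -mulNr addf_div ?tofrac_eq0 // -tofracN -!tofracM -tofracD.
rewrite !frac_mapE ?mulf_neq0 //.
rewrite -mulNr addf_div ?tofrac_eq0 ?phi_eq0 // -tofracN -!tofracM -tofracD.
by rewrite rmorphD !rmorphM rmorphN.
Qed.

Fact frac_map_is_monoid_morphism : monoid_morphism frac_map.
Proof.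
split=> [|x y]; first by rewrite -tofrac1 frac_map_tofrac rmorph1.
rewrite (frac_reprE x) (frac_reprE y).
move: (frac _).1 (frac _).2 (denom_ratioP (generic_quotient.repr x)) => a b b0.
move: (frac _).1 (frac _).2 (denom_ratioP (generic_quotient.repr y)) => c d d0.
rewrite mulf_div -!tofracM !frac_mapE ?mulf_neq0 //.
by rewrite mulf_div -!tofracM !rmorphM.
Qed.

End FracMap.

Section RatFun.
Context {k : closedFieldType} {n : nat}.
Notation M := 'rV[int]_n.
Notation K := (ratfun k n).

Definition ratX (i : 'I_n) : K := tofrac (mpoly.mpolyX k (mpoly.mnm1 i)).

Definition ratC (c : k) : K := tofrac (mpoly.mpolyC n c).

Definition chi (m : M) : K := \prod_i ratX i ^ m 0 i.

Lemma ratX_neq0 i : ratX i != 0.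
Proof.
rewrite tofrac_eq0; apply/eqP => /mpoly.mpolyP/(_ (mpoly.mnm1 i))/eqP.
by rewrite mpoly.mcoeffX eqxx mpoly.mcoeff0 oner_eq0.
Qed.

Lemma chiD m m' : chi (m + m') = chi m * chi m'.
Proof.
rewrite /chi -big_split; apply: eq_bigr => i _ /=.
by rewrite mxE expfzDr ?ratX_neq0.
Qed.

Lemma msym_inj (w : 'S_n) : injective (@mpoly.msym n k w).
Proof.
move=> p q e; apply/mpoly.mpolyP => m.
pose m' := mpoly.Multinom [tuple m (w^-1%g i) | i < n].
have <- : mpoly.Multinom [tuple m' (w i) | i < n] = m.
  by apply/mpoly.mnmP => i; rewrite !mpoly.mnmE permK.
by rewrite -!mpoly.mcoeff_sym e.
Qed.

(* f |-> f o w for the action of w on the torus: x_i |-> x_{w^-1(i)}, that is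
   chi^m |-> chi^(w^-1 m). *)
Definition pull (w : 'S_n) : K -> K := frac_map (@mpoly.msym n k w^-1%g).

HB.instance Definition _ w := GRing.isZmodMorphism.Build K K (pull w)
  (frac_map_is_zmod_morphism (@msym_inj w^-1%g)).
HB.instance Definition _ w := GRing.isMonoidMorphism.Build K K (pull w)
  (frac_map_is_monoid_morphism (@msym_inj w^-1%g)).

Lemma pull_chi w m : pull w (chi m) = chi (lact w^-1%g m).
Proof.
rewrite /chi rmorph_prod [RHS](reindex_perm w^-1%g); apply: eq_bigr => i _.
rewrite lactE permK rmorphXz ?unitfE ?ratX_neq0 //; congr (_ ^ _).
rewrite /= /pull /ratX (frac_map_tofrac (@msym_inj _)) /= /mpoly.msym.
by rewrite mpoly.mmapX mpoly.mmap1U.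
Qed.

Lemma pull_ratC w c : pull w (ratC c) = ratC c.
Proof.
rewrite /pull /ratC (frac_map_tofrac (@msym_inj _)) /= /mpoly.msym.
by rewrite mpoly.mmapC.
Qed.

End RatFun.

Section Toric.
Context (k : closedFieldType) {R : realType} {n : nat}.
Context (Sigma : set (set 'rV[R]_n)).
Notation M := 'rV[int]_n.
Notation NR := 'rV[R]_n.
Notation K := (ratfun k n).
Implicit Types (sigma tau : set NR) (m : M) (w : 'S_n) (f : K).

(* sigma^\vee \cap M and sigma^\perp \cap M *)
Definition dual_cone sigma : set M :=
  [set m | forall v, sigma v -> 0 <= dot (emb m) v].
Definition perp_cone sigma : set M :=
  [set m | forall v, sigma v -> dot (emb m) v = 0].

(* The points of the affine chart U_tau = Spec k[tau^\vee \cap M] are the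
   monoid morphisms from tau^\vee \cap M to (k, * ), and U_sigma embeds in
   U_tau by restriction when sigma is a face of tau.  A point of the glued
   variety is recorded in the smallest chart U_sigma containing it, where it
   is a morphism that is nonzero exactly on sigma^\perp \cap M; it is then
   extended by zero outside sigma^\vee.  Thus pt_cone x = sigma says that x
   is in the torus orbit O(sigma). *)
Record toric_pt := ToricPt {
  pt_cone : set NR;
  pt_val : M -> k;
  pt_cone_fan : Sigma pt_cone;
  pt_val0 : pt_val 0 = 1;
  pt_valD : forall m m', dual_cone pt_cone m -> dual_cone pt_cone m' ->
    pt_val (m + m') = pt_val m * pt_val m';
  pt_val_neq0 : forall m, pt_val m != 0 <-> perp_cone pt_cone m
}.

Lemma toric_ptP (x y : toric_pt) :
  pt_cone x = pt_cone y -> pt_val x = pt_val y -> x = y.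
Proof.
case: x y => [s v p1 p2 p3 p4] [s' v' q1 q2 q3 q4] /= e e'; subst s' v'.
by congr ToricPt; exact: Prop_irrelevance.
Qed.

Definition chart tau : set toric_pt := [set x | pt_cone x `<=` tau].

(* Laurent polynomials, as lists of pairs (coefficient, exponent), their
   image in K and their value at a point; lp_on tau s means that s belongs to
   k[tau^\vee \cap M]. *)
Definition laurent := seq (k * M).
Implicit Types s t : laurent.
Definition lp_on tau s := forall a, a \in s -> dual_cone tau a.2.
Definition lp_rat s : K := \sum_(a <- s) ratC a.1 * chi a.2.
Definition lp_val (x : toric_pt) s : k := \sum_(a <- s) a.1 * pt_val x a.2.
Definition lp_mul s t : laurent :=
  [seq (a.1 * b.1, a.2 + b.2) | a <- s, b <- t].

Lemma dual_coneD sigma m m' :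
  dual_cone sigma m -> dual_cone sigma m' -> dual_cone sigma (m + m').
Proof.
move=> sm sm' v sv; suff -> : dot (emb (m + m')) v =
  dot (emb m) v + dot (emb m') v by apply: addr_ge0; [apply: sm|apply: sm'].
rewrite /dot -big_split; apply: eq_bigr => i _ /=.
by rewrite !mxE rmorphD mulrDl.
Qed.

Lemma dual_cone0 sigma : dual_cone sigma 0.
Proof.
by move=> v _; rewrite /dot big1 // => i _; rewrite !mxE mulr0z mul0r.
Qed.

Lemma lp_onS sigma tau s : sigma `<=` tau -> lp_on tau s -> lp_on sigma s.
Proof. by move=> st on a /on sa v /st; apply: sa. Qed.

Lemma lp_on_mul tau s t : lp_on tau s -> lp_on tau t -> lp_on tau (lp_mul s t).
Proof.
move=> ss st _ /allpairsP[[a b] /= [sa tb ->]] /=.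
by apply: dual_coneD; [apply: ss|apply: st].
Qed.

Lemma lp_on_cat tau s t : lp_on tau s -> lp_on tau t -> lp_on tau (s ++ t).
Proof. by move=> ss st a; rewrite mem_cat => /orP[/ss|/st]. Qed.

Lemma lp_rat_mul s t : lp_rat (lp_mul s t) = lp_rat s * lp_rat t.
Proof.
rewrite /lp_rat /lp_mul big_allpairs_dep mulr_suml; apply: eq_bigr => a _.
rewrite mulr_sumr; apply: eq_bigr => b _ /=.
by rewrite chiD /ratC mpoly.mpolyCM tofracM mulrACA.
Qed.

Lemma lp_val_mul x s t : lp_on (pt_cone x) s -> lp_on (pt_cone x) t ->
  lp_val x (lp_mul s t) = lp_val x s * lp_val x t.
Proof.
move=> ss st; rewrite /lp_val /lp_mul big_allpairs_dep mulr_suml.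
rewrite !big_seq; apply: eq_bigr => a sa.
rewrite mulr_sumr !big_seq; apply: eq_bigr => b tb /=.
by rewrite pt_valD; [rewrite mulrACA|apply: ss|apply: st].
Qed.

Lemma lp_rat_cat s t : lp_rat (s ++ t) = lp_rat s + lp_rat t.
Proof. by rewrite /lp_rat big_cat. Qed.

Lemma lp_val_cat x s t : lp_val x (s ++ t) = lp_val x s + lp_val x t.
Proof. by rewrite /lp_val big_cat. Qed.

(* The Zariski topology: U is open when its trace on every affine chart is a
   union of principal open subsets of that chart. *)
Definition zariski_open (U : set toric_pt) : Prop :=
  forall tau, Sigma tau -> forall x, U x -> chart tau x ->
    exists t, [/\ lp_on tau t, lp_val x t != 0
      & forall y, chart tau y -> lp_val y t != 0 -> U y].

Fact zariski_openT : zariski_open setT.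
Proof.
move=> tau _ x _ _; exists [:: (1, 0)]; split=> //.
  by move=> a; rewrite inE => /eqP ->; apply: dual_cone0.
by rewrite /lp_val big_seq1 pt_val0 mulr1 oner_eq0.
Qed.

Fact zariski_openI : setI_closed zariski_open.
Proof.
move=> U V oU oV tau Stau x [Ux Vx] tx.
have [s [ons sx sU]] := oU tau Stau x Ux tx.
have [t [ont tx0 tV]] := oV tau Stau x Vx tx.
exists (lp_mul s t); split; first exact: lp_on_mul.
  by rewrite lp_val_mul ?mulf_neq0 //; exact: lp_onS tx _.
move=> y ty; rewrite lp_val_mul; [|exact: lp_onS ty _|exact: lp_onS ty _].
by rewrite mulf_eq0 negb_or => /andP[? ?]; split; [apply: sU|apply: tV].
Qed.

Fact zariski_open_bigU (I : Type) (F : I -> set toric_pt) :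
  (forall i, zariski_open (F i)) -> zariski_open (\bigcup_i F i).
Proof.
move=> oF tau Stau x [i _ Fx] tx; have [t [ont tx0 tF]] := oF i tau Stau x Fx tx.
by exists t; split=> // y ty /(tF _ ty) Fy; exists i.
Qed.

HB.instance Definition _ := gen_eqMixin toric_pt.
HB.instance Definition _ := gen_choiceMixin toric_pt.
HB.instance Definition _ := isOpenTopological.Build toric_pt
  zariski_openT zariski_openI zariski_open_bigU.

Lemma zariskiP (U : set toric_pt) : open U <-> zariski_open U.
Proof. by []. Qed.

(* f belongs to the local ring O_{X,x}: f = s / t with s, t regular on the
   smallest chart containing x and t(x) <> 0, which forces lp_rat t <> 0. *)
Definition regular_at (x : toric_pt) (f : K) : Prop :=
  exists s t, [/\ lp_on (pt_cone x) s, lp_on (pt_cone x) t, lp_val x t != 0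
    & f * lp_rat t = lp_rat s].

Lemma regular_atD x f g :
  regular_at x f -> regular_at x g -> regular_at x (f + g).
Proof.
move=> [s [t [os ot t0 ef]]] [s' [t' [os' ot' t0' eg]]].
exists (lp_mul s t' ++ lp_mul s' t), (lp_mul t t'); split.
- by apply: lp_on_cat; apply: lp_on_mul.
- exact: lp_on_mul.
- by rewrite lp_val_mul ?mulf_neq0.
rewrite lp_rat_cat !lp_rat_mul -ef -eg mulrDl mulrA; congr (_ + _).
by rewrite mulrAC mulrA.
Qed.

Lemma regular_atM x f g :
  regular_at x f -> regular_at x g -> regular_at x (f * g).
Proof.
move=> [s [t [os ot t0 ef]]] [s' [t' [os' ot' t0' eg]]].
exists (lp_mul s s'), (lp_mul t t'); split; try exact: lp_on_mul.
  by rewrite lp_val_mul ?mulf_neq0.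
by rewrite !lp_rat_mul -ef -eg mulrACA.
Qed.

Lemma regular_at_ratC x (c : k) : regular_at x (ratC c).
Proof.
have E d : lp_rat [:: (d, 0)] = ratC d.
  rewrite /lp_rat big_seq1 /= /chi big1 ?mulr1 // => i _.
  by rewrite mxE expr0z.
have on d : lp_on (pt_cone x) [:: (d, 0)].
  by move=> a; rewrite inE => /eqP ->; apply: dual_cone0.
exists [:: (c, 0)], [:: (1, 0)]; split=> //.
  by rewrite /lp_val big_seq1 /= pt_val0 mulr1 oner_eq0.
by rewrite !E /ratC mpoly.mpolyC1 tofrac1 mulr1.
Qed.

Lemma regular_at1 x : regular_at x 1.
Proof.
by have := regular_at_ratC x 1; rewrite /ratC mpoly.mpolyC1 tofrac1.
Qed.

Lemma regular_atN x f : regular_at x f -> regular_at x (- f).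
Proof.
move=> rf; have := regular_atM (regular_at_ratC x (-1)) rf.
by rewrite /ratC mpoly.mpolyCN tofracN mpoly.mpolyC1 tofrac1 mulN1r.
Qed.

(* O_X(U), for U open and nonempty *)
Definition regular_on (U : set toric_pt) : {pred K} :=
  fun f => `[< forall x, U x -> regular_at x f >].

Fact regular_on_subring U : subring_closed (regular_on U).
Proof.
split=> [|f g /asboolP rf /asboolP rg|f g /asboolP rf /asboolP rg].
- by apply/asboolP => x _; apply: regular_at1.
- by apply/asboolP => x Ux; apply: regular_atD; [exact: rf|apply/regular_atN/rg].
- by apply/asboolP => x Ux; apply: regular_atM; [exact: rf|exact: rg].
Qed.

HB.instance Definition _ U := GRing.isSubringClosed.Build K (regular_on U)
  (regular_on_subring U).

Record regfun (U : set toric_pt) :=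
  RegFun { regfun_val :> K; regfunP : regfun_val \in regular_on U }.

HB.instance Definition _ U := [isSub for @regfun_val U].
HB.instance Definition _ U := [Choice of regfun U by <:].
HB.instance Definition _ U := [SubChoice_isSubComNzRing of regfun U by <:].

Lemma regfun_res_subproof (U V : set toric_pt) (a : regfun U) :
  V `<=` U -> regfun_val a \in regular_on V.
Proof.
by move=> VU; apply/asboolP => x /VU; have /asboolP := regfunP a; apply.
Qed.

Definition regfun_res (U V : set toric_pt) (VU : V `<=` U) (a : regfun U) :
  regfun V := RegFun (regfun_res_subproof a VU).

(* The empty open set is left out: every sheaf vanishes on it. *)
Record zopen := ZOpen {
  zset :> set toric_pt;
  zopenP : open zset;
  zopen_neq0 : zset !=set0
}.

(* Presheaves of O_X-modules.  Sheaves of O_X-modules are a full subcategory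
   of these, so two of them are isomorphic as sheaves iff they are as
   presheaves. *)
Record omodule := OModule {
  osec : forall U : zopen, lmodType (regfun U);
  ores : forall U V : zopen, V `<=` U -> osec U -> osec V;
  oresD : forall (U V : zopen) (VU : V `<=` U) (s t : osec U),
    ores VU (s + t) = ores VU s + ores VU t;
  oresZ : forall (U V : zopen) (VU : V `<=` U) (a : regfun U) (s : osec U),
    ores VU (a *: s) = regfun_res VU a *: ores VU s;
  ores_id : forall (U : zopen) (UU : U `<=` U) (s : osec U), ores UU s = s;
  ores_comp : forall (U V W : zopen) (VU : V `<=` U) (WV : W `<=` V) (WU : W `<=` U)
    (s : osec U), ores WV (ores VU s) = ores WU s
}.

Definition oiso (E F : omodule) : Prop :=
  exists phi : forall U, {linear osec E U -> osec F U},
    (forall U, bijective (phi U)) /\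
    (forall (U V : zopen) (VU : V `<=` U) (s : osec E U),
       phi V (ores VU s) = ores VU (phi U s)).

Definition irreducible_set (Z : set toric_pt) : Prop :=
  Z !=set0 /\ forall A B : set toric_pt, closed A -> closed B ->
    Z `<=` A `|` B -> Z `<=` A \/ Z `<=` B.

(* integral closed subvarieties of codimension 1 in the irreducible variety X *)
Definition prime_divisor (Z : set toric_pt) : Prop :=
  [/\ closed Z, irreducible_set Z, Z <> setT
    & forall Y : set toric_pt, closed Y -> irreducible_set Y ->
        Z `<=` Y -> Y = Z \/ Y = setT].

(* the local ring O_{X,Z} at the generic point of Z *)
Definition regular_along (Z : set toric_pt) (f : K) : Prop :=
  exists U : set toric_pt, [/\ open U, U `&` Z !=set0
    & forall x, U x -> regular_at x f].

(* pi generates the maximal ideal of O_{X,Z}; recall that 0^-1 = 0 in K *)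
Definition uniformizer (Z : set toric_pt) (pi : K) : Prop :=
  [/\ regular_along Z pi, ~ regular_along Z pi^-1
    & forall f, regular_along Z f -> ~ regular_along Z f^-1 ->
        regular_along Z (f / pi)].

(* ord_Z f >= j, for the discrete valuation of O_{X,Z} (X is normal) *)
Definition ord_ge (Z : set toric_pt) (j : int) (f : K) : Prop :=
  forall pi, uniformizer Z pi -> regular_along Z (f * pi ^ (- j)).

Definition weil_divisor := set toric_pt -> int.

(* O_X(D)(U) = {f | f = 0 or (div f + D)|_U >= 0}, for U open and nonempty *)
Definition Osheaf_on (D : weil_divisor) (U : set toric_pt) : {pred K} :=
  fun f => `[< forall Z, prime_divisor Z -> U `&` Z !=set0 ->
                 ord_ge Z (- D Z) f >].

Lemma regular_alongP Z f g h : irreducible_set Z ->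
  (forall x, regular_at x f -> regular_at x g -> regular_at x h) ->
  regular_along Z f -> regular_along Z g -> regular_along Z h.
Proof.
move=> [_ Zirr] fgh [U [oU [x [Ux Zx]] rf]] [V [oV [y [Vy Zy]] rg]].
exists (U `&` V); split; [exact: openI| |by move=> z [Uz Vz]; apply: fgh; auto].
apply: contrapT => /forallNP UVZ.
have [z Zz|ZU|ZV] := Zirr _ _ (open_closedC oU) (open_closedC oV).
- have [Uz|] := pselect (U z); last by left.
  by right=> Vz; apply: (UVZ z).
- exact: ZU Zx Ux.
- exact: ZV Zy Vy.
Qed.

Fact Osheaf_on_zmod D U : zmod_closed (Osheaf_on D U).
Proof.
split.
  apply/asboolP => Z [_ _ _ _] [x [_ Zx]] pi _; rewrite mul0r.
  exists setT; split=> [||y _]; first exact: openT.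
    by exists x.
  by rewrite -(subrr 1); apply/regular_atD/regular_atN; apply: regular_at1.
move=> f g /asboolP rf /asboolP rg; apply/asboolP => Z pZ UZ pi upi.
have irrZ : irreducible_set Z by case: pZ.
apply: (regular_alongP irrZ) (rf Z pZ UZ pi upi) (rg Z pZ UZ pi upi).
by move=> x rx rx'; rewrite mulrBl; apply/regular_atD/regular_atN.
Qed.

HB.instance Definition _ D U := GRing.isZmodClosed.Build K (Osheaf_on D U)
  (Osheaf_on_zmod D U).

Record Osection (D : weil_divisor) (U : set toric_pt) :=
  OSection { osection_val :> K; osectionP : osection_val \in Osheaf_on D U }.

HB.instance Definition _ D U := [isSub for @osection_val D U].
HB.instance Definition _ D U := [Choice of Osection D U by <:].
HB.instance Definition _ D U := [SubChoice_isSubZmodule of Osection D U by <:].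

Fact Osection_scale_subproof D (U : zopen) (a : regfun U) (f : Osection D U) :
  regfun_val a * osection_val f \in Osheaf_on D U.
Proof.
apply/asboolP => Z pZ UZ pi upi.
have /asboolP/(_ Z pZ UZ pi upi) rf := osectionP f.
have ra : regular_along Z a.
  exists U; split=> //; first exact: zopenP.
  by move=> x Ux; have /asboolP := regfunP a; apply.
have irrZ : irreducible_set Z by case: pZ.
apply: (regular_alongP irrZ) ra rf => x rx rx'.
by rewrite -mulrA; apply: regular_atM.
Qed.

Definition Osection_scale D (U : zopen) (a : regfun U) (f : Osection D U) :
  Osection D U := OSection (Osection_scale_subproof a f).

Section OsectionLmod.
Context (D : weil_divisor) (U : zopen).
Implicit Types (a b : regfun U).

Fact Osection_scaleA a b (f : Osection D U) :
  Osection_scale a (Osection_scale b f) = Osection_scale (a * b) f.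
Proof. by apply: val_inj; rewrite /= mulrA. Qed.
Fact Osection_scale1 : left_id 1 (@Osection_scale D U).
Proof. by move=> f; apply: val_inj; rewrite /= mul1r. Qed.
Fact Osection_scaleDr : right_distributive (@Osection_scale D U) +%R.
Proof. by move=> a f g; apply: val_inj; rewrite /= mulrDr. Qed.
Fact Osection_scaleDl (f : Osection D U) : {morph (@Osection_scale D U)^~ f : a b / a + b}.
Proof. by move=> a b; apply: val_inj; rewrite /= mulrDl. Qed.

HB.instance Definition _ := GRing.Zmodule_isLmodule.Build (regfun U)
  (Osection D U) Osection_scaleA Osection_scale1 Osection_scaleDr
  Osection_scaleDl.
End OsectionLmod.

Fact Osection_res_subproof D (U V : set toric_pt) (f : Osection D U) :
  V `<=` U -> osection_val f \in Osheaf_on D V.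
Proof.
move=> VU; apply/asboolP => Z pZ [x [Vx Zx]].
by have /asboolP := osectionP f; apply=> //; exists x; split=> //; apply: VU.
Qed.

Definition Osection_res D (U V : zopen) (VU : V `<=` U) (f : Osection D U) :
  Osection D V := OSection (Osection_res_subproof f VU).

Definition Osheaf (D : weil_divisor) : omodule.
Proof.
refine (@OModule (fun U : zopen => Osection D U : lmodType (regfun U)) (@Osection_res D) _ _ _ _).
- by move=> U V VU s t; apply: val_inj.
- by move=> U V VU a s; apply: val_inj.
- by move=> U UU s; apply: val_inj.
- by move=> U V W VU WV WU s; apply: val_inj.
Defined.

Definition cone_ray (v : M) : set NR := [set c *: emb v | c in [set c | 0 <= c]].

Definition primitive (v : M) : Prop :=
  \big[gcdn/0%N]_i absz (v 0 i) = 1%N.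

(* the primitive generators of the rays of Sigma *)
Definition ray_gens : set M := [set v | primitive v /\ Sigma (cone_ray v)].

(* D_rho: the closure of the orbit O(rho), for rho the ray of v *)
Definition ray_divisor (v : M) : set toric_pt :=
  closure [set x | pt_cone x = cone_ray v].

(* \sum_rho a_rho D_rho: the coefficient of Z is the sum of the a_rho over
   the (at most one) rho with D_rho = Z. *)
Definition toric_divisor (a : M -> int) : weil_divisor :=
  fun Z => \sum_(v \in [set v | ray_gens v /\ ray_divisor v = Z]) a v.

(* max_{x in P} <x, v>, an integer when P is a lattice polytope *)
Definition support_number (P : set NR) (v : M) : int :=
  Num.floor (sup [set dot x (emb v) | x in P]).

(* L_P = O_X(\sum_rho a_rho D_rho) *)
Definition line_bundle (P : set NR) : omodule :=
  Osheaf (toric_divisor (support_number P)).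

End Toric.

Definition restr_scalars (A B : pzRingType) (phi : {rmorphism A -> B})
  (V : lmodType B) : Type := V.

Section RestrictScalars.
Context {A B : pzRingType} (phi : {rmorphism A -> B}) (V : lmodType B).
Notation restr := (restr_scalars phi V).

HB.instance Definition _ := GRing.Zmodule.copy restr V.

Definition restr_scale (a : A) (v : restr) : restr := (phi a *: (v : V)).

Fact restr_scaleA a b v : restr_scale a (restr_scale b v) = restr_scale (a * b) v.
Proof. by rewrite /restr_scale rmorphM -scalerA. Qed.
Fact restr_scale1 : left_id 1 restr_scale.
Proof. by move=> v; rewrite /restr_scale rmorph1 scale1r. Qed.
Fact restr_scaleDr : right_distributive restr_scale +%R.
Proof. by move=> a u v; exact: scalerDr. Qed.
Fact restr_scaleDl v : {morph restr_scale^~ v : a b / a + b}.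
Proof. by move=> a b; rewrite /restr_scale rmorphD scalerDl. Qed.

HB.instance Definition _ := GRing.Zmodule_isLmodule.Build A restr
  restr_scaleA restr_scale1 restr_scaleDr restr_scaleDl.
End RestrictScalars.

Section Action.
Context (k : closedFieldType) {R : realType} {n : nat}.
Context {Sigma : set (set 'rV[R]_n)}.
Context (Sigma_stable : forall w sigma, Sigma sigma -> Sigma (lact w @` sigma)).
Notation M := 'rV[int]_n.
Notation X := (toric_pt k Sigma).
Implicit Types (w : 'S_n) (m : M) (x : X) (sigma tau : set 'rV[R]_n).

Lemma dot_emb_lact w m (v : 'rV[R]_n) :
  dot (emb m) (lact w v) = dot (emb (lact w^-1%g m)) v.
Proof. by rewrite -[X in emb X](lactVK w) emb_lact dot_lact. Qed.

Lemma dual_cone_lact w sigma m :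
  dual_cone (lact w @` sigma) m <-> dual_cone sigma (lact w^-1%g m).
Proof.
split=> [h v sv|h _ [v sv <-]]; last by rewrite dot_emb_lact; apply: h.
by rewrite -dot_emb_lact; apply: h; exists v.
Qed.

Lemma perp_cone_lact w sigma m :
  perp_cone (lact w @` sigma) m <-> perp_cone sigma (lact w^-1%g m).
Proof.
split=> [h v sv|h _ [v sv <-]]; last by rewrite dot_emb_lact; apply: h.
by rewrite -dot_emb_lact; apply: h; exists v.
Qed.

(* The toric automorphism induced by w : N -> N.  It maps U_sigma to
   U_{w sigma} by chi^m(w x) = chi^(w^-1 m)(x). *)
Definition toric_act w x : X.
Proof.
refine (@ToricPt k R n Sigma (lact w @` pt_cone x)
  (fun m => pt_val x (lact w^-1%g m)) _ _ _ _).
- exact: Sigma_stable (pt_cone_fan x).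
- by rewrite lact0 pt_val0.
- move=> m m' /dual_cone_lact sm /dual_cone_lact sm'.
  by rewrite lactD pt_valD.
- by move=> m; rewrite perp_cone_lact; exact: pt_val_neq0.
Defined.

Lemma toric_actM g w x :
  toric_act w (toric_act g x) = toric_act (g * w)%g x.
Proof.
apply: toric_ptP => /=.
  by rewrite image_comp; congr image; apply/funext => v /=; exact: lactM.
by apply/funext => m; rewrite lactM invMg.
Qed.

Lemma toric_actVK w x : toric_act w (toric_act w^-1%g x) = x.
Proof.
apply: toric_ptP => /=.
  rewrite image_comp (_ : _ \o _ = id) ?image_id //.
  by apply/funext => v /=; exact: lactVK.
by apply/funext => m; rewrite invgK lactVK.
Qed.

Definition lp_pull w (s : @laurent k n) : @laurent k n :=
  [seq (a.1, lact w^-1%g a.2) | a <- s].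

Lemma lp_val_act w x s : lp_val (toric_act w x) s = lp_val x (lp_pull w s).
Proof. by rewrite /lp_val big_map. Qed.

Lemma lp_rat_pull w s : lp_rat (lp_pull w s) = pull w (lp_rat s).
Proof.
rewrite /lp_rat big_map rmorph_sum; apply: eq_bigr => a _ /=.
by rewrite rmorphM /= pull_ratC pull_chi.
Qed.

Lemma lp_on_pull w tau s : lp_on (lact w @` tau) s -> lp_on tau (lp_pull w s).
Proof. by move=> on _ /mapP[a /on sa ->]; apply/dual_cone_lact. Qed.

Lemma open_act_preimage w (U : set X) : open U -> open (toric_act w @^-1` U).
Proof.
move=> /zariskiP oU; apply/zariskiP => tau Stau x Ux tx.
have sub y : chart tau y -> chart (lact w @` tau) (toric_act w y).
  by move=> ty _ [v yv <-]; exists v => //; apply: ty.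
have [t [ont t0 tU]] := oU _ (Sigma_stable w Stau) _ Ux (sub _ tx).
exists (lp_pull w t); split; [exact: lp_on_pull|by rewrite -lp_val_act|].
by move=> y ty; rewrite -lp_val_act; apply: tU (sub _ ty).
Qed.

Definition act_preimage w (U : zopen k Sigma) : zopen k Sigma.
Proof.
refine (@ZOpen k R n Sigma (toric_act w @^-1` U) _ _).
- exact/open_act_preimage/zopenP.
- have [x Ux] := zopen_neq0 U.
  by exists (toric_act w^-1%g x); rewrite /preimage /= toric_actVK.
Defined.

Lemma regular_at_pull w x f :
  regular_at (toric_act w x) f -> regular_at x (pull w f).
Proof.
move=> [s [t [os ot t0 ef]]]; exists (lp_pull w s), (lp_pull w t).
split; try exact: lp_on_pull; first by rewrite -lp_val_act.
by rewrite !lp_rat_pull -rmorphM /= ef.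
Qed.

Section Comorphism.
Context (w : 'S_n) (U : zopen k Sigma).

Fact regfun_pull_subproof (a : regfun U) :
  pull w (regfun_val a) \in regular_on (act_preimage w U).
Proof.
apply/asboolP => x Ux; apply: regular_at_pull.
by have /asboolP := regfunP a; apply.
Qed.

(* O_X(U) -> O_X(w^-1 U), f |-> f o w *)
Definition regfun_pull (a : regfun U) : regfun (act_preimage w U) :=
  RegFun (regfun_pull_subproof a).

Fact regfun_pull_is_zmod_morphism : zmod_morphism regfun_pull.
Proof. by move=> a b; apply: val_inj; rewrite /= rmorphB. Qed.
Fact regfun_pull_is_monoid_morphism : monoid_morphism regfun_pull.
Proof.
by split=> [|a b]; apply: val_inj; rewrite /= ?rmorph1 ?rmorphM.
Qed.

HB.instance Definition _ := GRing.isZmodMorphism.Build (regfun U)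
  (regfun (act_preimage w U)) regfun_pull regfun_pull_is_zmod_morphism.
HB.instance Definition _ := GRing.isMonoidMorphism.Build (regfun U)
  (regfun (act_preimage w U)) regfun_pull regfun_pull_is_monoid_morphism.
End Comorphism.

Lemma act_preimageS w (U V : zopen k Sigma) :
  V `<=` U -> act_preimage w V `<=` act_preimage w U.
Proof. by move=> VU x; apply: VU. Qed.

(* w . E: the direct image of E along the automorphism x |-> w x of X_Sigma,
   (w . E)(U) = E(w^-1 U), with f in O_X(U) acting through f o w. *)
Definition transport w (E : omodule k Sigma) : omodule k Sigma.
Proof.
refine (@OModule k R n Sigma
  (fun U => restr_scalars (@regfun_pull w U) (osec E (act_preimage w U)))
  (fun U V VU s => ores (act_preimageS VU) s) _ _ _ _).
- by move=> U V VU s t; exact: oresD.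
- move=> U V VU a s; apply: etrans (oresZ _ (regfun_pull w a) _) _.
  have -> : regfun_res (@act_preimageS w U V VU) (regfun_pull w a) =
      regfun_pull w (regfun_res VU a) by apply: val_inj.
  by [].
- by move=> U UU s; exact: ores_id.
- by move=> U V W VU WV WU s; exact: ores_comp.
Defined.

Definition Sn_invariant (I : Type) (E : I -> omodule k Sigma) : Prop :=
  forall (w : 'S_n) (i : I), exists j : I, oiso (transport w (E i)) (E j).

End Action.

Section Matroids.
Context {n : nat}.
Implicit Types (w : 'S_n) (S T I : {set 'I_n}).

Record matroid := Matroid {
  bases : {set {set 'I_n}};
  bases_neq0 : exists B, B \in bases;
  bases_exchange : forall A B, A \in bases -> B \in bases ->
    forall a, a \in A :\: B -> exists2 b, b \in B :\: A & b |: (A :\ a) \in bases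
}.

Definition indep (O : matroid) I : bool := [exists B in bases O, I \subset B].

(* the linear order w(1) <_w w(2) <_w ... <_w w(n) *)
Definition le_perm w : rel 'I_n := fun i j => (w^-1%g i <= w^-1%g j)%N.

Definition gale_le w S T : bool :=
  all2 (le_perm w) (sort (le_perm w) (enum S)) (sort (le_perm w) (enum T)).

Definition is_schubert (O : matroid) : Prop :=
  exists w S, forall T, (T \in bases O) = (#|T| == #|S|) && gale_le w S T.

Definition schubert_matroid := {O : matroid | is_schubert O}.

Definition IP (R : realType) (O : matroid) : set 'rV[R]_n :=
  conv [set \row_i (i \in I)%:R | I in [set I | indep O I]].

End Matroids.

(* Main.v *)
Require Import Defs.
From HB Require Import structures.
From mathcomp Require Import all_boot all_order all_fingroup all_algebra.
From mathcomp Require Import boolp classical_sets functions cardinality fsbigop.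
From mathcomp Require Import reals topology normedtype.
From mathcomp Require mpoly.
Import (canonicals, coercions) mpoly.

Set Implicit Arguments.
Unset Strict Implicit.
Unset Printing Implicit Defensive.

Import Order.TTheory GRing.Theory Num.Theory.
Local Open Scope classical_set_scope.
Local Open Scope ring_scope.

(* The bundle L_{IP(Omega)} is transported by w to L_{IP(w Omega)}.  On the
   combinatorial side, w maps the Schubert matroid of (v, S) to that of the
   permutation first v, then w, and the set w S; moreover IP(w Omega) is the
   image of IP(Omega) under w.  On the geometric side, the homeomorphism
   x |-> w x preserves prime divisors and, through pull w, their local rings,
   and it maps D_rho to D_{w rho}; hence f |-> f o w^-1 identifies the sections
   of w . O(D) with those of O(w D). *)

(** * Relabelling of matroids and of the Gale order *)

Section PermuteMatroid.
Context {n : nat}.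
Implicit Types (w : 'S_n) (S T I : {set 'I_n}) (O : @matroid n).

Lemma card_preimset_perm w T : #|w @^-1: T| = #|T|.
Proof. exact/card_preimset/perm_inj. Qed.

Lemma preimset_permK w T : w^-1%g @^-1: (w @^-1: T) = T.
Proof. by apply/setP => i; rewrite !inE permKV. Qed.

Lemma preimset_permVK w T : w @^-1: (w^-1%g @^-1: T) = T.
Proof. by apply/setP => i; rewrite !inE permK. Qed.

Fact matroid_perm_neq0 w O :
  exists B, B \in [set B : {set 'I_n} | w @^-1: B \in bases O]%SET.
Proof.
have [B OB] := bases_neq0 O.
by exists (w^-1%g @^-1: B); rewrite inE preimset_permVK.
Qed.

Fact matroid_perm_exchange w O A B :
  A \in [set B : {set 'I_n} | w @^-1: B \in bases O]%SET ->
  B \in [set B : {set 'I_n} | w @^-1: B \in bases O]%SET ->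
  forall a, a \in A :\: B -> exists2 b, b \in B :\: A &
    b |: (A :\ a) \in [set B : {set 'I_n} | w @^-1: B \in bases O]%SET.
Proof.
rewrite !inE => OA OB a /[!inE] aAB.
(* Exchange in [O] for the element [w^-1 a] yields [b]; the element to insert is then [w b]. *)
have [|b] := bases_exchange OA OB (a := w^-1%g a).
  by rewrite !inE permKV.
rewrite !inE => bBA Ob; exists (w b); rewrite !inE //.
suff -> : w @^-1: (w b |: A :\ a) = b |: (w @^-1: A) :\ w^-1%g a by [].
apply/setP => i; rewrite !inE (inj_eq perm_inj); congr (_ || (~~ _ && _)).
by rewrite -{1}(permKV w a) (inj_eq perm_inj).
Qed.

(** The matroid [w O], whose bases are the images under [w] of the bases of [O]; testing membership
    on preimages lets it unfold by rewriting. *)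
Definition matroid_perm w O : matroid :=
  Matroid (matroid_perm_neq0 w O) (@matroid_perm_exchange w O).

Lemma indep_perm w O I : indep (matroid_perm w O) I = indep O (w @^-1: I).
Proof.
apply/exists_inP/exists_inP => -[B OB IB].
  by exists (w @^-1: B); [rewrite inE in OB|exact: preimsetS].
exists (w^-1%g @^-1: B); first by rewrite inE preimset_permVK.
by rewrite -(preimset_permK w I); exact: preimsetS.
Qed.

Lemma le_perm_total w : total (le_perm w).
Proof. by move=> i j; exact: leq_total. Qed.

Lemma le_perm_trans w : transitive (le_perm w).
Proof. by move=> i j l; exact: leq_trans. Qed.

Lemma le_perm_anti w : antisymmetric (le_perm w).
Proof. by move=> i j /anti_leq/val_inj/perm_inj. Qed.

(** Since [v * w] applies [v] first, [w] is an order isomorphism from [le_perm v] to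
    [le_perm (v * w)]. The orders being total and antisymmetric, it then suffices to compare the
    elements of two duplicate-free lists. *)
Lemma sort_le_permM v w T :
  sort (le_perm (v * w)%g) (enum T) =
  map w (sort (le_perm v) (enum (w @^-1: T))).
Proof.
have wM i j : le_perm (v * w)%g (w i) (w j) = le_perm v i j.
  by rewrite /le_perm invMg !permM !permK.
rewrite (map_sort wM); apply/perm_sortP.
- exact: le_perm_total.
- exact: le_perm_trans.
- exact: le_perm_anti.
apply: uniq_perm; first exact: enum_uniq.
  by rewrite (map_inj_uniq (@perm_inj _ w)) enum_uniq.
move=> i; rewrite -{2}(permKV w i) (mem_map (@perm_inj _ w)).
by rewrite !mem_enum inE permKV.
Qed.

Lemma gale_le_permM v w S T :
  gale_le (v * w)%g S T = gale_le v (w @^-1: S) (w @^-1: T).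
Proof.
rewrite /gale_le !sort_le_permM.
(* The entrywise comparison is preserved by [w] for arbitrary lists, hence the generalisation before
   the induction. *)
move: (sort _ _) (sort _ _) => s t; elim: s t => [|i s IH] [|j t] //=.
by rewrite IH /le_perm invMg !permM !permK.
Qed.

Lemma is_schubert_perm w O : is_schubert O -> is_schubert (matroid_perm w O).
Proof.
move=> [v [S OS]]; exists (v * w)%g, (w^-1%g @^-1: S) => T.
by rewrite inE OS gale_le_permM preimset_permVK !card_preimset_perm.
Qed.

Definition schubert_perm w (O : @schubert_matroid n) : schubert_matroid :=
  exist _ (matroid_perm w (sval O)) (is_schubert_perm w (svalP O)).

End PermuteMatroid.

(** * Polytopes, support numbers and rays under permutation of coordinates *)

Section PermutePolytope.
Context {R : realType} {n : nat}.
Implicit Types (w : 'S_n) (P A : set 'rV[R]_n) (O : @matroid n).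

Lemma lact_imageK w A : lact w^-1%g @` (lact w @` A) = A.
Proof.
rewrite image_comp (_ : _ \o _ = id) ?image_id //.
by apply/funext => x; exact: lactK.
Qed.

Lemma lact_conv w A : lact w @` conv A = conv (lact w @` A).
Proof.
(* One inclusion for every permutation suffices: the reverse one follows from the case of [w^-1]. *)
have sub u B : lact u @` conv B `<=` conv (lact u @` B).
  move=> _ [_ [r [c [p [c0 c1 Bp ->]]]] <-]; exists r, c, (lact u \o p).
  split=> // [i|]; first by exists (p i).
  apply/rowP => j; rewrite lactE !summxE; apply: eq_bigr => i _.
  by rewrite !(lactE, mxE).
apply/seteqP; split=> [|x Ax]; first exact: sub.
exists (lact w^-1%g x); last exact: lactVK.
by rewrite -(lact_imageK w A); apply: sub; exists x.
Qed.

(** [lact w] sends the indicator vector of a set [J] to that of [w J], so the generators of the two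
    hulls correspond. *)
Lemma IP_perm w O : IP (matroid_perm w O) = lact w @` (IP O : set 'rV[R]_n).
Proof.
rewrite /IP lact_conv; congr conv; apply/seteqP; split.
  move=> _ [I OI <-].
  exists (\row_i (i \in w @^-1: I)%:R).
    by exists (w @^-1: I) => //=; rewrite -indep_perm.
  by apply/rowP => j; rewrite lactE !mxE inE permKV.
move=> _ [_ [I OI <-] <-]; exists (w^-1%g @^-1: I).
  by rewrite /= indep_perm preimset_permVK.
by apply/rowP => j; rewrite lactE !mxE inE.
Qed.

(** By invariance of the pairing, both suprema range over the same set of values. *)
Lemma support_number_lact w P v :
  support_number (lact w @` P) (lact w v) = support_number P v.
Proof.
rewrite /support_number; congr (Num.floor (sup _)); rewrite image_comp.
by congr image; apply/funext => x; rewrite /= emb_lact dot_lact.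
Qed.

Lemma cone_ray_lact w v :
  cone_ray (lact w v) = lact w @` (cone_ray v : set 'rV[R]_n).
Proof.
rewrite /cone_ray image_comp; congr image; apply/funext => c /=.
by rewrite emb_lact; apply/rowP => j; rewrite !(lactE, mxE).
Qed.

Lemma primitive_lact w (v : 'rV[int]_n) : primitive v -> primitive (lact w v).
Proof.
rewrite /primitive => v1; apply: etrans v1; rewrite (reindex_perm w).
by apply: eq_bigr => i _; rewrite lactE permK.
Qed.

End PermutePolytope.

(** * Action on the function field and on the Zariski topology *)

Section PermuteToric.
Context (k : closedFieldType) {R : realType} {n : nat}.
Context {Sigma : set (set 'rV[R]_n)}.
Context (Sigma_stable : forall w sigma, Sigma sigma -> Sigma (lact w @` sigma)).
Notation X := (toric_pt k Sigma).
Notation K := (ratfun k n).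
Notation act := (@toric_act k R n Sigma Sigma_stable).
Implicit Types (w : 'S_n) (Z U : set X) (f : K).

(** [pull] is defined through a chosen representative, so it is computed on quotients with nonzero
    denominator, where the claim reduces to [msym] being a group action on polynomials. *)
Lemma pull_permK w : cancel (@pull k n w) (pull w^-1%g).
Proof.
move=> f; rewrite (frac_reprE f).
set a := (frac _).1; set b := (frac _).2; have b0 : b != 0 := denom_ratioP _.
have pullE v (p q : mpoly.mpoly n k) : q != 0 ->
    pull v (tofrac p / tofrac q) =
    tofrac (mpoly.msym v^-1%g p) / tofrac (mpoly.msym v^-1%g q).
  by move=> q0; rewrite /pull (frac_mapE (@msym_inj _ _ _)).
have mb0 : mpoly.msym w^-1%g b != 0 by rewrite (phi_eq0 (@msym_inj _ _ _)).
rewrite (pullE _ _ _ b0) (pullE _ _ _ mb0).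
by rewrite -!mpoly.msymMm invgK mulVg !mpoly.msym1m.
Qed.

Lemma pull_permVK w : cancel (@pull k n w^-1%g) (pull w).
Proof. by move=> f; have := pull_permK w^-1%g f; rewrite invgK. Qed.

Lemma toric_actK w : cancel (act w) (act w^-1%g).
Proof.
by move=> x; have := toric_actVK Sigma_stable w^-1%g x; rewrite invgK.
Qed.

Lemma toric_act_preimageK w U : act w^-1%g @^-1` (act w @^-1` U) = U.
Proof. by apply/funext => x; rewrite /preimage /= toric_actVK. Qed.

Lemma toric_act_preimageVK w U : act w @^-1` (act w^-1%g @^-1` U) = U.
Proof. by apply/funext => x; rewrite /preimage /= toric_actK. Qed.

Lemma toric_act_preimage_setI_neq0 w U Z : U `&` Z !=set0 ->
  (act w @^-1` U) `&` (act w @^-1` Z) !=set0.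
Proof.
by move=> [x [Ux Zx]]; exists (act w^-1%g x); rewrite /preimage /= toric_actVK.
Qed.

Lemma toric_act_preimage_subset w U Z :
  act w @^-1` U `<=` act w @^-1` Z -> U `<=` Z.
Proof.
move=> UZ x Ux; rewrite -(toric_actVK Sigma_stable w x); apply: UZ.
by rewrite /preimage /= toric_actVK.
Qed.

Lemma closed_act_preimage w Z : closed Z -> closed (act w @^-1` Z).
Proof.
move=> cZ; rewrite -(setCK Z) -preimage_setC; apply: open_closedC.
exact: (@open_act_preimage _ _ _ _ _ _ (~` Z) (closed_openC cZ)).
Qed.

Lemma closure_act_preimage w Z : closure (act w @^-1` Z) = act w @^-1` closure Z.
Proof.
have sub u A : closure (act u @^-1` A) `<=` act u @^-1` closure A.
  have /closure_id -> : closed (act u @^-1` closure A).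
    by apply: closed_act_preimage; exact: closed_closure.
  by apply: closureS => x; exact: (@subset_closure _ A (act u x)).
apply/seteqP; split; first exact: sub.
(* The reverse inclusion is [sub] for [w^-1], once [Z] is written as a double preimage. *)
rewrite -{1}(toric_act_preimageK w Z) => x clx.
by rewrite -(toric_actK w x); apply: sub clx.
Qed.

Lemma irreducible_act_preimage w Z :
  irreducible_set Z -> irreducible_set (act w @^-1` Z).
Proof.
move=> [[x Zx] irrZ]; split.
  by exists (act w^-1%g x); rewrite /preimage /= toric_actVK.
move=> A B cA cB ZAB.
have [||y Zy|ZA|ZB] := irrZ (act w^-1%g @^-1` A) (act w^-1%g @^-1` B).
- exact: closed_act_preimage.
- exact: closed_act_preimage.
- by apply: ZAB; rewrite /preimage /= toric_actVK.
- by left=> y /ZA; rewrite /preimage /= toric_actK.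
- by right=> y /ZB; rewrite /preimage /= toric_actK.
Qed.

(** All the conditions are topological and [act w] is a homeomorphism; a larger [Y] is compared with
    [Z] after pulling it back along [w^-1]. *)
Lemma prime_divisor_act_preimage w Z :
  prime_divisor Z -> prime_divisor (act w @^-1` Z).
Proof.
move=> [cZ irrZ ZT maxZ]; split.
- exact: closed_act_preimage.
- exact: irreducible_act_preimage.
- by move=> wZT; apply: ZT; rewrite -(toric_act_preimageK w Z) wZT.
move=> Y cY irrY ZY.
have [||y Zy|YZ|YT] := maxZ (act w^-1%g @^-1` Y).
- exact: closed_act_preimage.
- exact: irreducible_act_preimage.
- by apply: ZY; rewrite /preimage /= toric_actVK.
- by left; rewrite -YZ toric_act_preimageVK.
- by right; rewrite -(toric_act_preimageVK w Y) YT.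
Qed.

(** * Local rings along divisors and orders of vanishing *)

Lemma regular_along_pull w Z f :
  regular_along Z f -> regular_along (act w @^-1` Z) (pull w f).
Proof.
move=> [U [oU UZ rf]]; exists (act w @^-1` U); split.
- exact: open_act_preimage.
- exact: toric_act_preimage_setI_neq0.
- by move=> x Ux; apply: regular_at_pull (rf _ Ux).
Qed.

Lemma regular_along_pullV w Z f :
  regular_along (act w @^-1` Z) f -> regular_along Z (pull w^-1%g f).
Proof. by move=> /(@regular_along_pull w^-1%g); rewrite toric_act_preimageK. Qed.

(** Uniformizers are characterised by [regular_along] alone. They are moved from the preimage back
    to [Z] because [ord_ge] quantifies over all uniformizers, so that [ord_ge_pull] starts from one
    on the preimage. *)
Lemma uniformizer_pullV w Z f :
  uniformizer (act w @^-1` Z) f -> uniformizer Z (pull w^-1%g f).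
Proof.
move=> [rf rfV unif]; split; first exact: regular_along_pullV.
  move=> /(@regular_along_pull w).
  by rewrite -fmorphV /= pull_permVK => /rfV.
move=> g rg rgV; have := unif (pull w g) (regular_along_pull w rg).
rewrite -fmorphV /= => h.
(* The quotient becomes the image under [pull w^-1] of [pull w g / f], to which [h] applies. *)
rewrite -[g](pull_permK w) -fmorphV -rmorphM /=.
apply: regular_along_pullV; apply: h => /regular_along_pullV.
by rewrite pull_permK.
Qed.

Lemma ord_ge_pull w Z j f : ord_ge Z j f -> ord_ge (act w @^-1` Z) j (pull w f).
Proof.
move=> Zf g /uniformizer_pullV/Zf/(@regular_along_pull w).
by rewrite rmorphM fmorphXz /= pull_permVK.
Qed.

Lemma Osheaf_on_pull w (D D' : weil_divisor k Sigma) U f :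
  (forall Z, D (act w @^-1` Z) = D' Z) ->
  f \in Osheaf_on D' U -> pull w f \in Osheaf_on D (act w @^-1` U).
Proof.
move=> DD' /asboolP Uf; apply/asboolP => Z pZ UZ.
(* [Z] is written as the preimage of its translate by [w], which is again prime and meets [U]. *)
rewrite -(toric_act_preimageVK w Z) DD'; apply/ord_ge_pull/Uf.
  exact: prime_divisor_act_preimage.
by rewrite -(toric_act_preimageK w U); apply: toric_act_preimage_setI_neq0.
Qed.

(** * Transport of the sheaf of a Weil divisor *)

Section TransportOsheaf.
Context (w : 'S_n) (D D' : weil_divisor k Sigma).
Context (DD' : forall Z, D (act w @^-1` Z) = D' Z).

Fact Osection_push_subproof (U : zopen k Sigma)
    (f : Osection D (act_preimage Sigma_stable w U)) :
  pull w^-1%g (osection_val f) \in Osheaf_on D' U.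
Proof.
(* [Osheaf_on_pull] is used for [w^-1], with the roles of [D] and [D'] exchanged. *)
rewrite -(toric_act_preimageK w U); apply: Osheaf_on_pull (osectionP f) => Z.
by rewrite -DD' toric_act_preimageVK.
Qed.

(** The source is typed as a section of the transported sheaf, so that scalars act on it through
    [regfun_pull]. *)
Definition Osection_push (U : zopen k Sigma)
    (f : osec (transport Sigma_stable w (Osheaf D)) U) : osec (Osheaf D') U :=
  OSection (Osection_push_subproof f).

Fact Osection_push_is_zmod_morphism (U : zopen k Sigma) :
   zmod_morphism (@Osection_push U).
Proof. by move=> f g; apply: val_inj; rewrite /= rmorphB. Qed.

(** On the source [a] acts as multiplication by [pull w a], which [pull w^-1] turns back into
    [a]. *)
Fact Osection_push_is_scalable (U : zopen k Sigma) :
   scalable (@Osection_push U).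
Proof. by move=> a f; apply: val_inj; rewrite /= rmorphM /= pull_permK. Qed.

HB.instance Definition _ (U : zopen k Sigma) :=
  GRing.isZmodMorphism.Build _ _ (@Osection_push U)
  (@Osection_push_is_zmod_morphism U).
HB.instance Definition _ (U : zopen k Sigma) :=
  GRing.isScalable.Build _ _ _ _ (@Osection_push U)
  (@Osection_push_is_scalable U).

Lemma Osection_push_bij (U : zopen k Sigma) : bijective (@Osection_push U).
Proof.
exists (fun f : Osection D' U =>
    OSection (Osheaf_on_pull DD' (osectionP f)) : Osection D _) => f.
  by apply: val_inj; rewrite /= pull_permVK.
by apply: val_inj; rewrite /= pull_permK.
Qed.

Lemma transport_Osheaf : oiso (transport Sigma_stable w (Osheaf D)) (Osheaf D').
Proof.
exists (fun U : zopen k Sigma => @Osection_push U); split=> [U|U V VU s].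
  exact: Osection_push_bij.
(* Restriction keeps the underlying rational function, so both sides have the same value. *)
exact: val_inj.
Qed.

End TransportOsheaf.

(** * Rays and torus-invariant divisors *)

Lemma ray_gens_lact w v : ray_gens Sigma v -> ray_gens Sigma (lact w v).
Proof.
move=> [pv Sv]; split; first exact: primitive_lact.
by rewrite cone_ray_lact; apply: Sigma_stable.
Qed.

(** [act w] maps the orbit of a cone to the orbit of its image cone, and closure commutes with
    preimage. *)
Lemma ray_divisor_lact w v :
  act w @^-1` ray_divisor (lact w v) = (ray_divisor v : set X).
Proof.
rewrite /ray_divisor -closure_act_preimage; congr closure.
apply/seteqP; split=> x /=; rewrite cone_ray_lact; last by move=> ->.
by move=> e; rewrite -(lact_imageK w (pt_cone x)) e lact_imageK.
Qed.

Lemma toric_divisor_lact w (P : set 'rV[R]_n) Z :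
  toric_divisor (support_number P) (act w @^-1` Z) =
  toric_divisor (support_number (lact w @` P)) Z.
Proof.
(* [lact w] is a bijection from the rays whose divisor is the preimage of [Z] to those whose divisor
   is [Z], and the coefficients agree along it. *)
rewrite /toric_divisor [RHS](@reindex_fsbig _ _ _ _ _ (lact w)
  [set v | ray_gens Sigma v /\ ray_divisor v = act w @^-1` Z]).
  by apply: eq_fsbigr => v _; rewrite support_number_lact.
split=> [v [rv vZ]|u v _ _ /(can_inj (@lactK _ _ w))//|v [rv vZ]].
  split; first exact: ray_gens_lact.
  by rewrite -(toric_act_preimageK w (ray_divisor _)) ray_divisor_lact vZ
    toric_act_preimageK.
exists (lact w^-1%g v); last exact: lactVK.
split; first exact: ray_gens_lact.
by rewrite -(ray_divisor_lact w) lactVK vZ.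
Qed.

Lemma transport_line_bundle w (P : set 'rV[R]_n) :
  oiso (transport Sigma_stable w (line_bundle k Sigma P))
       (line_bundle k Sigma (lact w @` P)).
Proof. exact/transport_Osheaf/toric_divisor_lact. Qed.

End PermuteToric.

Theorem proposition1p7 (R : realType) (k : closedFieldType)
    (k_char0 : [pchar k] =i pred0) (n : nat) (n_ge1 : (1 <= n)%N) :
  Sn_invariant (@stell_fan_stable R n)
    (fun Omega : @schubert_matroid n =>
       line_bundle k (@stell_fan R n) (IP (sval Omega))).
Proof.
move=> w O; exists (schubert_perm w O).
by rewrite /= IP_perm; exact: transport_line_bundle.
Qed.
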